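(* For any positive integer $m$, $$\sum_{n=0}^{\infty}\frac{\sum_{k=0}^{m-1}L_{2(m-k)(2m+1)^n}}{L_{(2m+1)^{n+1}}} = 1.$$
   Context: $L_n$ denotes the $n$-th Lucas number: $L_n=\alpha^n+\beta^n$, where $\alpha=\frac{1+\sqrt5}{2}$ and $\beta=\frac{1-\sqrt5}{2}$ (so $L_0=2$, $L_1=1$). *)

(* Defs.v *)
From mathcomp Require Import all_boot all_order all_algebra.

Set Implicit Arguments.
Unset Strict Implicit.
Unset Printing Implicit Defensive.

Import Order.TTheory GRing.Theory Num.Theory.
Local Open Scope ring_scope.

Definition alpha {R : rcfType} : R := (1 + Num.sqrt 5) / 2.

Definition beta {R : rcfType} : R := (1 - Num.sqrt 5) / 2.

Definition lucas {R : rcfType} (n : nat) : R := alpha ^+ n + beta ^+ n.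

(* Main.v *)
Require Import Defs.
From mathcomp Require Import all_boot all_order all_algebra.
From mathcomp Require Import all_classical all_reals all_analysis.
From mathcomp Require Import ring lra zify.

(* For odd p, alpha^p * beta^p = -1 gives L_p L_{2jp} = L_{(2j+1)p} - L_{(2j-1)p},
   which telescopes over j to L_p * \sum_(1 <= j <= m) L_{2jp} = L_{(2m+1)p} - L_p.
   With p = (2m+1)^n, the n-th term of the series is thus
   1/L_{(2m+1)^n} - 1/L_{(2m+1)^(n+1)}, and the series telescopes to 1/L_1 = 1. *)

Set Implicit Arguments.
Unset Strict Implicit.
Unset Printing Implicit Defensive.

Import Order.TTheory GRing.Theory Num.Theory.
Import numFieldNormedType.Exports.
Local Open Scope classical_set_scope.
Local Open Scope ring_scope.

Lemma sqr_sqrt5 (R : rcfType) : Num.sqrt 5 ^+ 2 = 5 :> R.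
Proof. by rewrite sqr_sqrtr. Qed.

Lemma alphaMbeta (R : rcfType) : alpha * beta = -1 :> R.
Proof. by rewrite /alpha /beta; have := sqr_sqrt5 R; lra. Qed.

Lemma sqr_alpha (R : rcfType) : alpha ^+ 2 = alpha + 1 :> R.
Proof. by rewrite /alpha; have := sqr_sqrt5 R; lra. Qed.

Lemma sqr_beta (R : rcfType) : beta ^+ 2 = beta + 1 :> R.
Proof. by rewrite /beta; have := sqr_sqrt5 R; lra. Qed.

Lemma lucas0 (R : rcfType) : lucas 0 = 2 :> R.
Proof. by rewrite /lucas !expr0. Qed.

Lemma lucas1 (R : rcfType) : lucas 1 = 1 :> R.
Proof. by rewrite /lucas !expr1 /alpha /beta; lra. Qed.

Lemma lucasSS (R : rcfType) n : lucas n.+2 = lucas n.+1 + lucas n :> R.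
Proof. by rewrite /lucas -addn2 !exprD sqr_alpha sqr_beta !exprS; ring. Qed.

(** Induction on two consecutive indices, as the recurrence demands. The bound by 1 feeds the linear
    one: adding [lucas n] raises [lucas n.+1] by at least 1. *)
Lemma lucas_ge (R : rcfType) n : 1 <= lucas n :> R /\ n%:R <= lucas n :> R.
Proof.
suff [] : (1 <= lucas n :> R /\ n%:R <= lucas n :> R) /\
          (1 <= lucas n.+1 :> R /\ n.+1%:R <= lucas n.+1 :> R) by [].
elim: n => [|n [[h1 h2] [h3 h4]]]; first by rewrite lucas0 lucas1; lra.
by split=> //; rewrite lucasSS -(natr1 n.+1); lra.
Qed.

Lemma lucas_gt0 (R : rcfType) n : 0 < lucas n :> R.
Proof. by have [/(lt_le_trans ltr01)] := lucas_ge R n. Qed.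

Lemma lucasM (R : rcfType) p r : odd p ->
  lucas p * lucas (p + r) = lucas (p + p + r) - lucas r :> R.
Proof.
move=> op; rewrite /lucas !exprD.
have : alpha ^+ p * beta ^+ p = -1 :> R.
  by rewrite -exprMn alphaMbeta -signr_odd op expr1.
move: (alpha ^+ p) (beta ^+ p) => a b ab.
(* The cross terms are grouped around [a * b], so that replacing it by -1 turns them into
   [- lucas r]. *)
transitivity (a * a * alpha ^+ r + b * b * beta ^+ r
              + a * b * (alpha ^+ r + beta ^+ r)); first by ring.
by rewrite ab; ring.
Qed.

Lemma lucas_sum (R : rcfType) m p : odd p ->
  lucas p * (\sum_(0 <= k < m) lucas (2 * (m - k) * p)) =
  lucas ((2 * m + 1) * p) - lucas p :> R.
Proof.
move=> op; elim: m => [|m IH].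
  by rewrite big_nil mulr0 muln0 add0n mul1n subrr.
(* The new term is the one at [k = 0]: the summand depends on [m - k], so shifting [k] turns the
   remaining terms into the sum for [m]. *)
rewrite big_nat_recl // mulrDr.
under eq_bigr do rewrite subSS.
rewrite IH.
have -> : (2 * (m.+1 - 0) * p = p + (2 * m + 1) * p)%N by lia.
rewrite lucasM //.
have -> : (p + p + (2 * m + 1) * p = (2 * m.+1 + 1) * p)%N by lia.
by ring.
Qed.

Theorem theorem4 (R : realType) (m : nat) (hm : (0 < m)%N) :
  series (fun n : nat =>
    (\sum_(0 <= k < m) lucas (2 * (m - k) * (2 * m + 1) ^ n)%N)
      / lucas ((2 * m + 1) ^ n.+1)%N : R) @ \oo --> (1 : R).
Proof.
pose v n : R := (lucas ((2 * m + 1) ^ n)%N)^-1.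
(* The partial sum runs over indices below [n], so the telescoped value is [v 0 - v n], with
   [v 0 = 1] because [lucas 1 = 1]. *)
have seriesE : series (fun n : nat =>
    (\sum_(0 <= k < m) lucas (2 * (m - k) * (2 * m + 1) ^ n)%N)
      / lucas ((2 * m + 1) ^ n.+1)%N : R) = (fun n => 1 - v n).
  apply/funext => n; rewrite /series /=.
  elim: n => [|n IH]; first by rewrite big_nil /v expn0 lucas1 invr1 subrr.
  rewrite big_nat_recr //= IH /v.
  have on : odd ((2 * m + 1) ^ n) by rewrite oddX oddD oddM /= orbT.
  have := lucas_sum R m on; rewrite -expnS.
  set S := \sum_(_ <= _ < _) _.
  have := lucas_gt0 R ((2 * m + 1) ^ n); have := lucas_gt0 R ((2 * m + 1) ^ n.+1).
  move: (lucas (_ ^ n.+1)) (lucas (_ ^ n)) => y x y0 x0 E.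
  have -> : S = (y - x) / x by rewrite -E mulrC mulKf ?gt_eqF.
  by field; rewrite !gt_eqF.
rewrite seriesE -[X in _ --> X]subr0; apply: cvgB; first exact: cvg_cst.
(* [harmonic n] is 1/(n+1), so the upper bound amounts to n+1 <= L_{(2m+1)^n}. *)
apply: (@squeeze_cvgr _ _ _ _ (fun=> 0) harmonic) (cvg_cst _) cvg_harmonic.
apply: nearW => n; rewrite /v invr_ge0 ltW ?lucas_gt0 //=.
rewrite lef_pV2 ?posrE ?lucas_gt0 ?ltr0Sn //.
apply: le_trans (lucas_ge R _).2.
(* n < (2m+1)^n holds since the base exceeds 1; this is where [hm] enters. *)
by rewrite ler_nat ltn_expl //; lia.
Qed.
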